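(* Let $(u_h^0,\dot d_h^0,d_h^0)\in V_h\times W_h\times W_h$ be initial values for the fluid velocity, the solid velocity and the solid displacement and, for $n\ge1$, let $(u_h^n,p_h^n,\dot d_h^n,d_h^n,\lambda_h^n)\in V_h\times Q_h\times W_h\times W_h\times\Lambda_h$ be the solution of Algorithm 2 (described in the context) with extrapolation order $r=1$ or $r=2$. Let $\tau$ and $h_s$ be such that there exists $\alpha>0$ with $$\frac{\tau\beta_sC_I^2}{h_s^2}\le\alpha,\qquad \tau\alpha<\rho_s\epsilon .$$ Then for all $n\ge1$ $$E_h^n+\tilde D_h^n\ \lesssim\ \exp\Big(\tau\sum_{m=1}^n\frac{\alpha}{\rho_s\epsilon-\tau\alpha}\Big)E_h^0,$$ where $$E_h^n=\rho_f\|u_h^n\|_{0,\Omega}^2+\rho_s\epsilon\|\dot d_h^n\|_{0,\Sigma}^2+\|d_h^n\|_s^2\quad(n\ge0),$$ $$\tilde D_h^n=\tau\sum_{k=1}^n\big(\|\varepsilon(u_h^k)\|_{0,\Omega}^2+|p_h^k|_{s_h}^2\big)+\tau^2\sum_{k=1}^n\big(\rho_f\|\partial_\tau u_h^k\|_{0,\Omega}^2+\rho_s\epsilon\|\partial_\tau\dot d_h^k\|_{0,\Sigma}^2\big)\quad(n\ge1).$$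
   Context: Let $N\in\{2,3\}$, $\Omega\subset\mathbb R^N$ a polygonal domain, $\Sigma$ a fixed $(N-1)$-dimensional reference configuration of a thin solid, $\phi_0:\Sigma\to\Omega$ its position map. Constants $\rho_f,\rho_s,\epsilon,\mu>0$. $(\cdot,\cdot)_{0,\cdot}$ are $L^2$ scalar products; $\varepsilon(u)=\frac12(\nabla u+\nabla u^T)$. The symbol $a\lesssim b$ means $a\le Cb$ with a generic constant $C>0$. $V=H^1_0(\Omega)^N$; $Q=L^2_0(\Omega)$; $W\subset H^1(\Sigma)^N$ is the closed subspace of admissible solid displacements (homogeneous Dirichlet conditions, if any). $a^s:W\times W\to\mathbb R$ is symmetric, bilinear, coercive for the $H^1(\Sigma)$-norm and continuous with constant $\beta_s$: $a^s(d,w)\le\beta_s\|d\|_{1,\Sigma}\|w\|_{1,\Sigma}$; $\|w\|_s=a^s(w,w)^{1/2}$. Discretization: $\{\mathcal T_h\}$ is a regular family of simplicial triangulations of $\Omega$ with mesh size $h_f$ ($h_K$ the diameter of $K$), $\{\mathcal S_h\}$ a quasi-uniform family of simplicial triangulations of $\Sigma$ with mesh size $h_s$. With $X_h$, $Y_h$ the spaces of continuous piecewise affine functions on $\mathcal T_h$, $\mathcal S_h$: $V_h=V\cap X_h^N$, $Q_h=Q\cap X_h$, $W_h=W\cap Y_h^N$, $\Lambda_h=Y_h^N$. $C_I$ is the constant of the inverse inequality $\|w_h\|_{1,\Sigma}\le C_Ih_s^{-1}\|w_h\|_{0,\Sigma}$ for $w_h\in W_h$. On discrete functions $c(\cdot,\cdot)$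 is the $L^2(\Sigma)^N$ scalar product. $s_h(p_h,q_h)=\gamma\sum_Kh_K^2\int_K\nabla p_h\cdot\nabla q_h$, $\gamma>0$ fixed, $|q_h|_{s_h}^2=s_h(q_h,q_h)$, and $$a_h^f((u_h,p_h),(v_h,q_h))=2\mu(\varepsilon(u_h),\varepsilon(v_h))_{0,\Omega}-(p_h,\operatorname{div}v_h)_{0,\Omega}+(q_h,\operatorname{div}u_h)_{0,\Omega}+s_h(p_h,q_h).$$ Time step $\tau>0$; $\partial_\tau g^n=(g^n-g^{n-1})/\tau$. Algorithm 2. Extrapolation: $d_h^{n,\star}=d_h^{n-1}$ if $r=1$, $d_h^{n,\star}=d_h^{n-1}+\tau\dot d_h^{n-1}$ if $r=2$. With $\phi_h^0=\phi_0+d_h^0$, for $n\ge1$: (1) find $(u_h^n,p_h^n,\dot d_h^n,\lambda_h^n)\in V_h\times Q_h\times W_h\times\Lambda_h$ such that for all $(v_h,q_h,w_h,\mu_h)\in V_h\times Q_h\times W_h\times\Lambda_h$ $$\rho_f(\partial_\tau u_h^n,v_h)_{0,\Omega}+a_h^f((u_h^n,p_h^n),(v_h,q_h))+c(\lambda_h^n,v_h\circ\phi_h^{n-1}-w_h)-c(\mu_h,u_h^n\circ\phi_h^{n-1}-\dot d_h^n)+\tfrac{\rho_s\epsilon}{\tau}(\dot d_h^n-\dot d_h^{n-1},w_h)_{0,\Sigma}=-a^s(d_h^{n,\star},w_h);$$ (2) $d_h^n=d_h^{n-1}+\tau\dot d_h^n$; (3) $\phi_h^n=\phi_0+d_h^n$.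 The deformed solid is assumed to stay inside the fluid region, $\phi_h^n(\Sigma)\subset\Omega$ for all $n$, so the compositions are defined. *)

(* Defs.v *)
From HB Require Import structures.
From mathcomp Require Import all_boot all_order all_algebra.
From mathcomp Require Import all_classical all_reals all_analysis.

Set Implicit Arguments.
Unset Strict Implicit.
Unset Printing Implicit Defensive.
Import Order.TTheory GRing.Theory Num.Theory.
Import numFieldNormedType.Exports.
Local Open Scope classical_set_scope.
Local Open Scope ring_scope.

Definition rV_display : measure_display.
Proof. exact: default_measure_display. Qed.

Section Lebesgue_rV.
Variable R : realType.

(* Product sigma-algebra, i.e. the Borel sigma-algebra of R^n. *)
Definition rV_measurable n : set (set 'rV[R]_n) :=
  g_sigma_preimage (fun (i : 'I_n) (x : 'rV[R]_n) => x 0 i).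

Let rV_set0 n : @rV_measurable n set0.
Proof. exact: sigma_algebra0. Qed.

Let rV_setC n A : @rV_measurable n A -> rV_measurable (~` A).
Proof. exact: sigma_algebraC. Qed.

Let rV_bigcup n (F : (set 'rV[R]_n)^nat) :
  (forall i, rV_measurable (F i)) -> rV_measurable (\bigcup_i F i).
Proof. exact: sigma_algebra_bigcup. Qed.

HB.instance Definition _ n := @isMeasurable.Build rV_display 'rV[R]_n
  (@rV_measurable n) (@rV_set0 n) (@rV_setC n) (@rV_bigcup n).

Definition consrV n (p : R * 'rV[R]_n) : 'rV[R]_n.+1 := row_mx p.1%:M p.2.

Lemma measurable_coord n (i : 'I_n) :
  measurable_fun [set: 'rV[R]_n] (fun x : 'rV[R]_n => x 0 i).
Proof.
move=> _ Y mY; rewrite setTI; apply: sub_sigma_algebra => /=.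
rewrite -bigcup_seq/=; exists i => /=; first by rewrite mem_index_enum.
by exists Y => //; rewrite setTI.
Qed.

Lemma measurable_consrV n : measurable_fun setT (@consrV n).
Proof.
move=> _ A mA; rewrite setTI.
have : g_sigma_preimage
    (fun (i : 'I_n.+1) (p : R * 'rV[R]_n) => consrV p 0 i) `<=` measurable.
  apply: smallest_sub; first exact: sigma_algebra_measurable.
  rewrite -bigcup_seq/= => B [i _ [C mC <-]].
  suff mi : measurable_fun [set: R * 'rV[R]_n] (fun p => consrV p 0 i).
    exact: mi.
  case: (@split_ordP 1 n i) => j ->.
    rewrite (_ : (fun p => _) = fst); first exact: measurable_fst.
    by apply/funext => p; rewrite /consrV (row_mxEl p.1%:M) ord1 mxE eqxx.
  rewrite (_ : (fun p => _) = (fun x : 'rV[R]_n => x 0 j) \o snd).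
    exact: measurableT_comp (measurable_coord j) measurable_snd.
  by apply/funext => p; rewrite /consrV (row_mxEr p.1%:M).
apply; rewrite (g_sigma_preimage_comp (fun i (x : 'rV[R]_n.+1) => x 0 i)).
by exists A => //; rewrite setTI.
Qed.

Definition leb_cons n (mu : {measure set 'rV[R]_n -> \bar R}) :
    set 'rV[R]_n.+1 -> \bar R :=
  pushforward (lebesgue_measure \x^ mu)%E (@consrV n).

HB.instance Definition _ n mu := Measure.copy (@leb_cons n mu)
  (measure_function_pushforward__canonical__measure_function_Measure
    (lebesgue_measure \x^ mu)%E (@measurable_consrV n)).

Fixpoint leb n : {measure set 'rV[R]_n -> \bar R} :=
  if n is m.+1 then leb_cons (leb m) else dirac (0 : 'rV[R]_0).
End Lebesgue_rV.

Section Sobolev.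
Variables (R : realType) (n : nat).
Implicit Types (D : set 'rV[R]_n) (f g phi : 'rV[R]_n -> R) (i : 'I_n).

(* Functions on D are total functions; their values off D are irrelevant, and
   a.e. equal functions are not identified. *)
Definition sqint D f : Prop :=
  measurable_fun D f /\ (leb R n).-integrable D (fun x => (f x ^+ 2)%:E).

Definition ip D f g : R := \int[leb R n]_(x in D) (f x * g x).

Definition norm0 D f : R := Num.sqrt (ip D f f).

Definition basis_vec i : 'rV[R]_n := delta_mx 0 i.

Definition partials (s : seq 'I_n) f : 'rV[R]_n -> R :=
  foldr (fun i g => 'D_(basis_vec i) g) f s.

Definition smooth f : Prop := forall s,
  continuous (partials s f) /\
  forall i x, derivable (partials s f) x (basis_vec i).

Definition test_fun D phi : Prop := smooth phi /\
  exists K, [/\ compact K, K `<=` D & forall x, ~ K x -> phi x = 0].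

Definition weak_partial D i f g : Prop :=
  [/\ sqint D f, sqint D g &
    forall phi, test_fun D phi ->
      ip D f ('D_(basis_vec i) phi) = - ip D g phi].

Definition H1 D f : Prop :=
  sqint D f /\ forall i, exists g, weak_partial D i f g.

(* A representative of the weak partial derivative; meaningful on H1 D. *)
Definition wpartial D i f : 'rV[R]_n -> R :=
  xget (cst 0) [set g | weak_partial D i f g].

Definition grad D f (x : 'rV[R]_n) : 'rV[R]_n := \row_i wpartial D i f x.

Definition norm1 D f : R :=
  Num.sqrt (ip D f f + \sum_i ip D (wpartial D i f) (wpartial D i f)).

Definition H10 D f : Prop := H1 D f /\
  exists2 phi : nat -> 'rV[R]_n -> R, (forall k, test_fun D (phi k)) &
    (fun k => norm1 D (fun x => f x - phi k x)) @ \oo --> (0 : R).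

Definition L20 D f : Prop :=
  sqint D f /\ \int[leb R n]_(x in D) f x = 0.

End Sobolev.

Section Vector_valued.
Variables (R : realType) (n m : nat).
Implicit Types (D : set 'rV[R]_n) (u v w : 'rV[R]_n -> 'rV[R]_m).

Definition comp u (i : 'I_m) (x : 'rV[R]_n) : R := u x 0 i.

Definition vip D u v : R := \sum_i ip D (comp u i) (comp v i).

Definition vnorm0 D u : R := Num.sqrt (vip D u u).

Definition vnorm1 D u : R := Num.sqrt (\sum_i norm1 D (comp u i) ^+ 2).

Definition vH1 D : set ('rV[R]_n -> 'rV[R]_m) :=
  [set u | forall i, H1 D (comp u i)].

Definition vH10 D : set ('rV[R]_n -> 'rV[R]_m) :=
  [set u | forall i, H10 D (comp u i)].

(* The last clause also makes W invariant under a.e. modification. *)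
Definition closed_H1_subspace D (W : set ('rV[R]_n -> 'rV[R]_m)) : Prop :=
  [/\ W `<=` vH1 D, W (fun=> 0),
      forall (a : R) v w, W v -> W w -> W (fun x => a *: v x + w x) &
      forall (w_ : nat -> 'rV[R]_n -> 'rV[R]_m) w,
        (forall k, W (w_ k)) -> vH1 D w ->
        (fun k => vnorm1 D (fun x => w_ k x - w x)) @ \oo --> (0 : R) -> W w].

Definition elastic_form D (W : set ('rV[R]_n -> 'rV[R]_m))
    (a : ('rV[R]_n -> 'rV[R]_m) -> ('rV[R]_n -> 'rV[R]_m) -> R) (beta : R) :
    Prop :=
  [/\ forall v w, W v -> W w -> a v w = a w v,
      forall (c : R) u v w, W u -> W v -> W w ->
        a (fun x => c *: u x + v x) w = c * a u w + a v w,
      exists2 c : R, 0 < c & forall w, W w -> c * vnorm1 D w ^+ 2 <= a w w &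
      forall v w, W v -> W w -> a v w <= beta * vnorm1 D v * vnorm1 D w].

End Vector_valued.

Section Meshes.
Variables (R : realType) (n : nat).
Implicit Types (D A : set 'rV[R]_n) (f : 'rV[R]_n -> R).

(* The n.+1 rows are the vertices. *)
Definition simplex := 'M[R]_(n.+1, n).
Implicit Types (K L : simplex) (T : seq simplex).

Definition face K (A : {set 'I_n.+1}) : set 'rV[R]_n :=
  [set x | exists t : 'rV[R]_n.+1,
    [/\ forall i, 0 <= t 0 i, forall i, i \notin A -> t 0 i = 0,
        \sum_i t 0 i = 1 & x = t *m K]].

Definition hull K : set 'rV[R]_n := face K [set: 'I_n.+1].

Definition nondegenerate K : Prop :=
  row_free (row_mx K (const_mx 1 : 'cV[R]_n.+1)).

Definition covered T : set 'rV[R]_n := [set x | exists2 K, K \in T & hull K x].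

(* Boundedness and openness follow; slits are excluded by taking the interior.
   Connectedness is not part of it. *)
Definition polyhedral D : Prop := D !=set0 /\
  exists T, (forall K, K \in T -> nondegenerate K) /\ D = (covered T)°.

(* Two distinct elements meet in a common proper face, possibly empty (A = set0);
   properness rules out listing one simplex twice with permuted vertices. *)
Definition triangulation D T : Prop :=
  [/\ uniq T, forall K, K \in T -> nondegenerate K,
      closure D = covered T &
      forall K L, K \in T -> L \in T -> K != L ->
        exists A B : {set 'I_n.+1},
          [/\ A != [set: 'I_n.+1]%SET, hull K `&` hull L = face K A
            & face K A = face L B]].

Definition enorm (x : 'rV[R]_n) : R := Num.sqrt (\sum_i x 0 i ^+ 2).

Definition diam A : R := sup [set enorm (x - y) | x in A & y in A].

Definition inball_diam A : R :=
  sup [set r *+ 2 | r in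
    [set r : R | 0 < r /\ exists c, forall x, enorm (x - c) <= r -> A x]].

Definition mesh_size T : R := \big[Num.max/0]_(K <- T) diam (hull K).

Definition regular_family D (J : Type) (T : J -> seq simplex) : Prop :=
  (forall j, triangulation D (T j)) /\
  exists2 sigma : R, 0 < sigma & forall j K, K \in T j ->
    diam (hull K) <= sigma * inball_diam (hull K).

Definition quasi_uniform_family D (J : Type) (T : J -> seq simplex) : Prop :=
  regular_family D T /\
  exists2 c : R, 0 < c & forall j K, K \in T j ->
    mesh_size (T j) <= c * diam (hull K).

Definition P1 D T : set ('rV[R]_n -> R) :=
  [set f | {within closure D, continuous f} /\
    forall K, K \in T -> exists (a : 'rV[R]_n) (b : R),
      forall x, hull K x -> f x = \sum_i a 0 i * x 0 i + b].

Definition vP1 m D T : set ('rV[R]_n -> 'rV[R]_m) :=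
  [set u | forall i, P1 D T (comp u i)].

End Meshes.

Section Fluid.
Variables (R : realType) (N : nat).
Variables (Om : set 'rV[R]_N) (T : seq (simplex R N)).
Implicit Types (u v : 'rV[R]_N -> 'rV[R]_N) (p q : 'rV[R]_N -> R).

Definition strain u (i j : 'I_N) (x : 'rV[R]_N) : R :=
  (wpartial Om j (comp u i) x + wpartial Om i (comp u j) x) / 2.

Definition strain_ip u v : R :=
  \sum_i \sum_j ip Om (strain u i j) (strain v i j).

Definition strain_norm u : R := Num.sqrt (strain_ip u u).

Definition divergence u (x : 'rV[R]_N) : R := \sum_i wpartial Om i (comp u i) x.

(* hull K and hull K `&` Om differ by a null set; grad p lives on Om. *)
Definition stab (gamma : R) p q : R :=
  gamma * \sum_(K <- T) diam (hull K) ^+ 2 *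
    vip (hull K `&` Om) (grad Om p) (grad Om q).

Definition stab_norm (gamma : R) q : R := Num.sqrt (stab gamma q q).

Definition fluid_form (mu gamma : R) u p v q : R :=
  2 * mu * strain_ip u v - ip Om p (divergence v) + ip Om q (divergence u)
  + stab gamma p q.

Definition Vh : set ('rV[R]_N -> 'rV[R]_N) := vH10 Om `&` vP1 Om T.

Definition Qh : set ('rV[R]_N -> R) := L20 Om `&` P1 Om T.

End Fluid.

Section Scheme.
Variables (R : realType) (N k : nat).
Variables (Om : set 'rV[R]_N) (Sigma : set 'rV[R]_k).
Variable phi0 : 'rV[R]_k -> 'rV[R]_N.
Variable W : set ('rV[R]_k -> 'rV[R]_N).
Variable a_s : ('rV[R]_k -> 'rV[R]_N) -> ('rV[R]_k -> 'rV[R]_N) -> R.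
Variables (Th : seq (simplex R N)) (Sh : seq (simplex R k)).
Variables (rhof rhos eps mu gamma tau : R).
Implicit Types (u : nat -> 'rV[R]_N -> 'rV[R]_N) (p : nat -> 'rV[R]_N -> R).
Implicit Types (ddot d lam : nat -> 'rV[R]_k -> 'rV[R]_N).

Definition Wh : set ('rV[R]_k -> 'rV[R]_N) := W `&` vP1 Sigma Sh.

Definition Lambdah : set ('rV[R]_k -> 'rV[R]_N) := vP1 Sigma Sh.

Definition dtau (l m : nat) (g : nat -> 'rV[R]_l -> 'rV[R]_m) (n : nat)
  (x : 'rV[R]_l) : 'rV[R]_m := tau^-1 *: (g n x - g n.-1 x).

Definition position d (n : nat) (x : 'rV[R]_k) : 'rV[R]_N := phi0 x + d n x.

Definition extrapolation (r : nat) ddot d (n : nat) (x : 'rV[R]_k) :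
    'rV[R]_N :=
  if r == 1%N then d n.-1 x else d n.-1 x + tau *: ddot n.-1 x.

Definition snorm (w : 'rV[R]_k -> 'rV[R]_N) : R := Num.sqrt (a_s w w).

(* The sequences solve the scheme with extrapolation order r (1 or 2) from the
   initial values u 0, ddot 0, d 0; p 0 and lam 0 are not used. *)
Definition scheme_solution (r : nat) u p ddot d lam : Prop :=
  [/\ Vh Om Th (u 0%N), Wh (ddot 0%N), Wh (d 0%N),
      forall n x, Sigma x -> Om (position d n x) &
      forall n, (1 <= n)%N ->
        [/\ [/\ Vh Om Th (u n), Qh Om Th (p n), Wh (ddot n), Wh (d n)
              & Lambdah (lam n)],
            forall vh qh wh muh,
              Vh Om Th vh -> Qh Om Th qh -> Wh wh -> Lambdah muh ->
              rhof * vip Om (dtau u n) vh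
              + fluid_form Om Th mu gamma (u n) (p n) vh qh
              + vip Sigma (lam n)
                  (fun x => vh (position d n.-1 x) - wh x)
              - vip Sigma muh
                  (fun x => u n (position d n.-1 x) - ddot n x)
              + rhos * eps / tau *
                  vip Sigma (fun x => ddot n x - ddot n.-1 x) wh
              = - a_s (extrapolation r ddot d n) wh
          & forall x, Sigma x -> d n x = d n.-1 x + tau *: ddot n x]].

Definition energy u ddot d (n : nat) : R :=
  rhof * vnorm0 Om (u n) ^+ 2 + rhos * eps * vnorm0 Sigma (ddot n) ^+ 2
  + snorm (d n) ^+ 2.

Definition dissipation u p ddot (n : nat) : R :=
  tau * (\sum_(1 <= m < n.+1)
    (strain_norm Om (u m) ^+ 2 + stab_norm Om Th gamma (p m) ^+ 2))
  + tau ^+ 2 * (\sum_(1 <= m < n.+1)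
    (rhof * vnorm0 Om (dtau u m) ^+ 2
     + rhos * eps * vnorm0 Sigma (dtau ddot m) ^+ 2)).

End Scheme.

(* Main.v *)
(* Testing the scheme with its own solution cancels the pressure and coupling
   terms.  Since [d n = d n.-1 + tau * ddot n], the elastic extrapolation leaves
   [tau^2 |ddot n|_s^2] (r = 1) or at most [tau^2 |ddot n - ddot n.-1|_s^2]
   (r = 2).  The inverse inequality bounds it by [tau * alpha] times an L2 norm
   that already occurs in [F n], the energy at step n plus the dissipation
   accumulated so far; hence [F n <= F n.-1 + theta * F n] with
   [theta = tau * alpha / (rhos * eps) < 1], and
   [1 / (1 - theta) = 1 + tau * alpha / (rhos * eps - tau * alpha)]. *)
Require Import Defs.
From HB Require Import structures.
From mathcomp Require Import all_boot all_order all_algebra.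
From mathcomp Require Import all_classical all_reals all_analysis.
From mathcomp Require Import measurable_realfun ring lra.

Set Implicit Arguments.
Unset Strict Implicit.
Unset Printing Implicit Defensive.
Import Order.TTheory GRing.Theory Num.Theory.
Import numFieldNormedType.Exports.
Local Open Scope classical_set_scope.
Local Open Scope ring_scope.

(** * Borel measurability of open sets in R^n *)

(** The sigma-algebra is generated by the coordinates, so an open set is written as the countable
    union of the boxes [B q] inside it, with rational centre and radius 1/(k+1). Each box is a
    finite intersection of coordinate preimages. *)
Lemma open_measurable_rV (R : realType) (n : nat) (A : set 'rV[R]_n) :
  open A -> measurable A.
Proof.
move=> oA.
pose B (q : 'rV[rat]_n * nat) : set 'rV[R]_n :=
  \bigcap_(i in [set: 'I_n])
    [set y | ball (ratr (q.1 0 i) : R) q.2.+1%:R^-1 (y 0 i)].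
have mB q : measurable (B q).
  apply: fin_bigcap_measurable => [|i _]; first exact: finite_finset.
  rewrite -[X in measurable X]setTI.
  exact: (measurable_coord (R := R) i measurableT (measurable_ball _ _)).
have -> : A = \bigcup_q (if `[< B q `<=` A >] then B q else set0).
  apply/seteqP; split => [x Ax|x [q _]]; last first.
    by case: asboolP => // BA /BA.
  have /nbhs_ballP[e /= e0 eA] := open_nbhs_nbhs (conj oA Ax).
  (* Below e/2, any point of a box containing x is within e of x by the triangle inequality through
     the centre. *)
  have [k ke] : exists k : nat, k.+1%:R^-1 < e / 2.
    have [k _ kP] := near_infty_natSinv_lt (PosNum (divr_gt0 e0 (ltr0Sn _ 1))).
    by exists k; exact: kP (leqnn k).
  have k0 : (0 : R) < k.+1%:R^-1 by rewrite invr_gt0.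
  have /choice[q qx] (i : 'I_n) :
      exists q : rat, ball (ratr q : R) k.+1%:R^-1 (x 0 i).
    have [|q] := @rat_in_itvoo R (x 0 i) (x 0 i + k.+1%:R^-1).
      by rewrite ltrDl.
    rewrite in_itv/= => /andP[xq qx]; exists q.
    by rewrite /ball/= gtr0_norm ?subr_gt0// ltrBlDl.
  have Bx : B (\row_i q i, k) x by move=> i _ /=; rewrite mxE.
  exists (\row_i q i, k) => //.
  case: asboolP => // -[] y By; apply: eA; split => // i j.
  rewrite ord1 (splitr e).
  apply: (@ball_triangle _ _ (ratr (q j) : R)).
    by apply: ball_sym; apply: le_ball (qx j); exact: ltW.
  by have /= := By j I; rewrite mxE; apply: le_ball; exact: ltW.
apply: countable_bigcupT_measurable => // q.
by case: asboolP.
Qed.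

Lemma polyhedral_measurable (R : realType) (n : nat) (A : set 'rV[R]_n) :
  polyhedral A -> measurable A.
Proof.
by move=> [_ [T [_ ->]]]; apply: open_measurable_rV; exact: open_interior.
Qed.

(** * Square-integrable scalar functions and their L2 product *)

Section L2.
Variables (R : realType) (n : nat) (D : set 'rV[R]_n).
Hypothesis mD : measurable D.
Implicit Types f g h : 'rV[R]_n -> R.

(** Domination by |f g| <= f^2 + g^2. *)
Lemma sqint_mul_integrable f g : sqint D f -> sqint D g ->
  (leb R n).-integrable D (EFin \o (fun x => f x * g x)).
Proof.
move=> [mf f2] [mg g2].
apply: (@le_integrable _ _ _ _ _ mD _
  (fun x => (f x ^+ 2)%:E + (g x ^+ 2)%:E)%E).
- by apply/measurable_EFinP; exact: measurable_funM.
- move=> x _ /=; rewrite lee_fin normrM.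
  rewrite [leRHS]ger0_norm ?addr_ge0 ?sqr_ge0//.
  rewrite -(real_normK (num_real (f x))) -(real_normK (num_real (g x))).
  nra.
- exact: integrableD.
Qed.

Lemma ipC f g : ip D f g = ip D g f.
Proof. by apply: eq_Rintegral => x _; rewrite mulrC. Qed.

Lemma eq_ip f f' g g' : {in D, f =1 f'} -> {in D, g =1 g'} ->
  ip D f g = ip D f' g'.
Proof. by move=> ff gg; apply: eq_Rintegral => x xD; rewrite ff// gg. Qed.

Lemma ip_ge0 f : 0 <= ip D f f.
Proof. by apply: Rintegral_ge0 => x _; rewrite -expr2 sqr_ge0. Qed.

(** The shape c (f - g) serves both [dtau], with c = 1/tau, and plain increments, with c = 1. *)
Lemma ipZ c f g h : sqint D f -> sqint D g -> sqint D h ->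
  ip D (fun x => c * (f x - g x)) h = c * (ip D f h - ip D g h).
Proof.
move=> sf sg sh.
rewrite -RintegralB//; try exact: sqint_mul_integrable.
rewrite -RintegralZl//; last first.
  exact: integrableB (sqint_mul_integrable sf sh) (sqint_mul_integrable sg sh).
by apply: eq_Rintegral => x _; ring.
Qed.

Lemma sqintZ c f g : sqint D f -> sqint D g ->
  sqint D (fun x => c * (f x - g x)).
Proof.
move=> sf sg; have [[mf f2] [mg g2]] := (sf, sg); split.
  by apply: measurable_funM => //; exact: measurable_funB.
apply: (@eq_integrable _ _ _ _ _ mD (fun x => (c ^+ 2)%:E *
  ((f x ^+ 2)%:E + ((- 2)%:E * (f x * g x)%:E + (g x ^+ 2)%:E)))%E).
  by move=> x _; rewrite -!(EFinM, EFinD); congr EFin; ring.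
apply: integrableZl => //; apply: integrableD => //; apply: integrableD => //.
by apply: integrableZl => //; exact: sqint_mul_integrable.
Qed.

End L2.

(** * Vector-valued L2 products, and norms depending only on values in D *)

Section vL2.
Variables (R : realType) (n m : nat) (D : set 'rV[R]_n).
Hypothesis mD : measurable D.
Implicit Types u v w : 'rV[R]_n -> 'rV[R]_m.

Lemma vip_ge0 u : 0 <= vip D u u.
Proof. by apply: sumr_ge0 => i _; exact: ip_ge0. Qed.

Lemma vnorm0_sqr u : vnorm0 D u ^+ 2 = vip D u u.
Proof. by rewrite sqr_sqrtr// vip_ge0. Qed.

Lemma compZB c u v i :
  Defs.comp (fun x => c *: (u x - v x)) i =
  (fun x => c * (Defs.comp u i x - Defs.comp v i x)).
Proof. by apply/funext => x; rewrite /Defs.comp !mxE. Qed.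

Lemma vip_scale_sub c u v w : (forall i, sqint D (Defs.comp u i)) ->
  (forall i, sqint D (Defs.comp v i)) -> (forall i, sqint D (Defs.comp w i)) ->
  vip D (fun x => c *: (u x - v x)) w = c * (vip D u w - vip D v w).
Proof.
move=> su sv sw; rewrite /vip -sumrB mulr_sumr; apply: eq_bigr => i _.
by rewrite compZB ipZ.
Qed.

Lemma vnorm0_scale_sub c u v : (forall i, sqint D (Defs.comp u i)) ->
  (forall i, sqint D (Defs.comp v i)) ->
  vnorm0 D (fun x => c *: (u x - v x)) ^+ 2 =
  c ^+ 2 * (vip D u u - 2 * vip D v u + vip D v v).
Proof.
move=> su sv; rewrite vnorm0_sqr /vip mulr_sumr -sumrB -big_split mulr_sumr/=.
apply: eq_bigr => i _; rewrite compZB.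
set f := Defs.comp u i; set g := Defs.comp v i.
have sf : sqint D f by exact: su.
have sg : sqint D g by exact: sv.
have ipE h : sqint D h ->
    ip D h (fun x => c * (f x - g x)) = c * (ip D f h - ip D g h).
  by move=> sh; rewrite ipC ipZ.
rewrite ipZ//; last exact: sqintZ.
rewrite (ipE f)// (ipE g)// (ipC D f g).
ring.
Qed.

(** [weak_partial] sees f only through its values on D, so both functions have the same set of weak
    derivatives and [xget] picks the same element of it. *)
Lemma wpartial_eq (f g : 'rV[R]_n -> R) (i : 'I_n) : {in D, f =1 g} ->
  wpartial D i f = wpartial D i g.
Proof.
move=> fg; rewrite /wpartial; congr xget.
have wp (f1 f2 h : 'rV[R]_n -> R) : {in D, f1 =1 f2} -> weak_partial D i f1 h ->
    weak_partial D i f2 h.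
  move=> f12 [[mf1 if1] sh wf1]; split => //.
    split; first exact: (eq_measurable_fun f1).
    by apply: eq_integrable if1 => // x xD; rewrite f12.
  by move=> phi tphi; rewrite -wf1//; apply: eq_ip => // x /f12.
apply/seteqP; split => h /=; apply: wp => //.
by move=> x /fg.
Qed.

Lemma norm1_eq (f g : 'rV[R]_n -> R) : {in D, f =1 g} ->
  norm1 D f = norm1 D g.
Proof.
move=> fg; have E1 := eq_ip fg fg.
(* [rewrite E1] would try to unify [f] with [wpartial] terms and diverge. *)
have E2 : \sum_i ip D (wpartial D i f) (wpartial D i f) =
          \sum_i ip D (wpartial D i g) (wpartial D i g).
  by apply: eq_bigr => i _; rewrite (wpartial_eq i fg).
exact: (f_equal2 (fun x y : R => Num.sqrt (x + y)) E1 E2).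
Qed.

Lemma vnorm1_eq u v : {in D, u =1 v} -> vnorm1 D u = vnorm1 D v.
Proof.
move=> uv; rewrite /vnorm1.
have E i : norm1 D (Defs.comp u i) = norm1 D (Defs.comp v i).
  by apply: norm1_eq => x /uv; rewrite /Defs.comp => ->.
have Es : \sum_i norm1 D (Defs.comp u i) ^+ 2 =
          \sum_i norm1 D (Defs.comp v i) ^+ 2.
  by apply: eq_bigr => i _; exact: (f_equal (fun y => y ^+ 2) (E i)).
exact: (f_equal Num.sqrt Es).
Qed.

Lemma vnorm1_ge0 u : 0 <= vnorm1 D u. Proof. exact: sqrtr_ge0. Qed.

End vL2.

(** * Algebra of the elastic form on W *)

Section Elastic.
Variables (R : realType) (n m : nat) (D : set 'rV[R]_n).
Hypothesis mD : measurable D.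
Variables (W : set ('rV[R]_n -> 'rV[R]_m))
  (a : ('rV[R]_n -> 'rV[R]_m) -> ('rV[R]_n -> 'rV[R]_m) -> R) (beta : R).
Hypotheses (hW : closed_H1_subspace D W) (ha : elastic_form D W a beta).
Implicit Types v w z : 'rV[R]_n -> 'rV[R]_m.

Lemma closed_H1_subspace_lincomb c v w :
  W v -> W w -> W (fun x => c *: v x + w x).
Proof. by have [_ _ + _] := hW; apply. Qed.

Lemma elastic_form_sym v w : W v -> W w -> a v w = a w v.
Proof. by have [+ _ _ _] := ha; apply. Qed.

Lemma elastic_form_lincomb c u v w : W u -> W v -> W w ->
  a (fun x => c *: u x + v x) w = c * a u w + a v w.
Proof. by have [_ + _ _] := ha; apply. Qed.

Lemma elastic_form_ge0 w : W w -> 0 <= a w w.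
Proof.
have [_ _ [c c0 ca] _] := ha => /ca; apply: le_trans.
by rewrite mulr_ge0 ?sqr_ge0 ?ltW.
Qed.

(** Linearity applied to 0 = 1 * 0 + 0 gives a(0,w) = 2 a(0,w). *)
Lemma elastic_form0l w : W w -> a (fun=> 0) w = 0.
Proof.
have [_ W0 _ _] := hW => Ww.
have := elastic_form_lincomb 1 W0 W0 Ww.
rewrite (_ : (fun x : 'rV[R]_n => 1 *: (0 : 'rV[R]_m) + 0) = (fun=> 0)).
  by rewrite mul1r; lra.
by apply/funext => x; rewrite scaler0 addr0.
Qed.

(** For the zero function, coercivity gives c |0|_1^2 <= a(0,0) = 0; this avoids computing the
    representatives chosen for its weak derivatives. *)
Lemma vnorm1_null z : (forall x, D x -> z x = 0) -> vnorm1 D z = 0.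
Proof.
have [_ W0 _ _] := hW; have [_ _ [c c0 ca] _] := ha => z0.
have -> : vnorm1 D z = vnorm1 D (fun=> 0 : 'rV[R]_m).
  by apply: vnorm1_eq => // x; rewrite inE => /z0.
have := ca _ W0; rewrite elastic_form0l// pmulr_rle0// => h.
by apply/eqP; rewrite -sqrf_eq0 eq_le h sqr_ge0.
Qed.

(* Forms act on functions on the whole space, so that values off [D] have to be
   shown irrelevant. *)
Lemma elastic_form_null z w : W z -> W w -> (forall x, D x -> z x = 0) ->
  a z w = 0.
Proof.
have [_ W0 _ _] := hW; have [_ _ _ ab] := ha => Wz Ww z0.
(* Continuity bounds [a] only from above; using this bound for both z and -z yields equality. *)
have h z' : W z' -> (forall x, D x -> z' x = 0) -> a z' w <= 0.
  by move=> Wz' /vnorm1_null E; have := ab _ _ Wz' Ww; rewrite E mulr0 mul0r.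
apply/eqP; rewrite eq_le h//=.
have : a (fun x => (-1) *: z x + 0) w <= 0.
  apply: h => [|x /z0 ->]; first exact: closed_H1_subspace_lincomb W0.
  by rewrite scaler0 addr0.
by rewrite elastic_form_lincomb// elastic_form0l// addr0 mulN1r oppr_le0.
Qed.

(** Meant for the displacement update, with t = tau. The update is known on D only, so d is compared
    with [e], which is t w + d' everywhere: their difference vanishes on D and is invisible to the
    form. *)
Lemma elastic_form_expand t d d' w : W d -> W d' -> W w ->
  (forall x, D x -> d x = d' x + t *: w x) ->
  a d d = a d' d' + 2 * t * a d' w + t ^+ 2 * a w w.
Proof.
move=> Wd Wd' Ww dE.
pose e := fun x => t *: w x + d' x.
have We : W e by exact: closed_H1_subspace_lincomb.
have dv v : W v -> a d v = t * a w v + a d' v.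
  move=> Wv; rewrite -elastic_form_lincomb//.
  have : a (fun x => (-1) *: e x + d x) v = 0.
    apply: elastic_form_null => //; first exact: closed_H1_subspace_lincomb.
    by move=> x /dE ->; rewrite /e scaleN1r [d' x + _]addrC addNr.
  by rewrite (elastic_form_lincomb (-1) We Wd Wv) mulN1r addrC => /subr0_eq.
rewrite dv// (elastic_form_sym Ww Wd) (elastic_form_sym Wd' Wd) !dv//.
rewrite (elastic_form_sym Ww Wd').
ring.
Qed.

Lemma elastic_form_sub v w : W v -> W w ->
  a (fun x => v x - w x) (fun x => v x - w x) = a v v - 2 * a w v + a w w.
Proof.
move=> Wv Ww.
have E : (fun x => v x - w x) = (fun x => (-1) *: w x + v x).
  by apply/funext => x; rewrite scaleN1r addrC.
have Wvw : W (fun x => v x - w x).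
  by rewrite E; exact: closed_H1_subspace_lincomb.
have dv z : W z -> a (fun x => v x - w x) z = - a w z + a v z.
  by move=> Wz; rewrite E elastic_form_lincomb// mulN1r.
rewrite dv// (elastic_form_sym Ww Wvw) (elastic_form_sym Wv Wvw) !dv//.
rewrite (elastic_form_sym Wv Ww).
ring.
Qed.

Lemma snorm_sqr w : W w -> snorm a w ^+ 2 = a w w.
Proof. by move=> Ww; rewrite sqr_sqrtr// elastic_form_ge0. Qed.

Lemma closed_H1_subspace_sqint w i : W w -> sqint D (Defs.comp w i).
Proof. by have [WH _ _ _] := hW => /WH /(_ i)[]. Qed.

End Elastic.

(** * Discrete differences and nonnegative fluid terms *)

Lemma P1B (R : realType) n (D : set 'rV[R]_n) T f g :
  P1 D T f -> P1 D T g -> P1 D T (fun x => f x - g x).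
Proof.
move=> [cf pf] [cg pg]; split.
  by move=> x; apply: cvgB; [exact: cf|exact: cg].
move=> K KT; have [a1 [b1 E1]] := pf _ KT; have [a2 [b2 E2]] := pg _ KT.
exists (a1 - a2), (b1 - b2) => x Kx; rewrite E1// E2//.
under [in RHS]eq_bigr => i _ do rewrite !mxE mulrBl.
rewrite sumrB; ring.
Qed.

(** Allows the inverse inequality to be applied to velocity increments, as the case r = 2
    requires. *)
Lemma WhB (R : realType) N k (Sigma : set 'rV[R]_k)
    (W : set ('rV[R]_k -> 'rV[R]_N)) T v w :
  closed_H1_subspace Sigma W -> Wh Sigma W T v -> Wh Sigma W T w ->
  Wh Sigma W T (fun x => v x - w x).
Proof.
move=> hW [Wv pv] [Ww pw]; split.
  rewrite (_ : (fun x => _) = (fun x => (-1) *: w x + v x)).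
    exact: (closed_H1_subspace_lincomb hW).
  by apply/funext => x; rewrite scaleN1r addrC.
move=> i; rewrite (_ : Defs.comp _ i =
    (fun x => Defs.comp v i x - Defs.comp w i x)); first exact: P1B.
by apply/funext => x; rewrite /Defs.comp !mxE.
Qed.

Lemma strain_ip_ge0 (R : realType) N (Om : set 'rV[R]_N) u :
  0 <= strain_ip Om u u.
Proof. by do 2!apply: sumr_ge0 => ? _; exact: ip_ge0. Qed.

Lemma stab_ge0 (R : realType) N (Om : set 'rV[R]_N) T gamma p :
  0 <= gamma -> 0 <= stab Om T gamma p p.
Proof.
move=> g0; rewrite mulr_ge0//; apply: sumr_ge0 => K _.
by rewrite mulr_ge0 ?sqr_ge0 ?vip_ge0.
Qed.

(** * A discrete Gronwall inequality with an implicit right-hand side *)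

(** With F k the energy plus the accumulated D, the step hypothesis gives (1 - theta) F (k+1) <= F
    k, hence a growth factor 1 + eta <= exp(eta) per step. *)
Lemma discrete_gronwall (R : realType) (E D : nat -> R) (theta eta : R) :
  0 <= E 0%N -> 0 <= theta -> theta < 1 -> (1 + eta) * (1 - theta) = 1 ->
  (forall k, 0 <= D k) ->
  (forall k, E k.+1 + D k.+1 <= E k + theta * (E k.+1 + D k.+1)) ->
  forall k, E k + \sum_(1 <= m < k.+1) D m <= expR (k%:R * eta) * E 0%N.
Proof.
move=> E0 t0 t1 et D0 step; elim=> [|k IH].
  by rewrite big_nil mul0r expR0 mul1r addr0.
set F := E k + _ in IH; rewrite big_nat_recr//=.
set S := \sum_(1 <= m < k.+1) D m in F IH *.
have S0 : 0 <= S by exact: sumr_ge0.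
have eta1 : 0 < 1 + eta.
  have /pmulr_lgt0 <- : 0 < 1 - theta by rewrite subr_gt0.
  by rewrite et.
(* Adding S to the step inequality and the nonnegative theta S to its right-hand side puts all of F
   (k+1) behind theta; multiplying by 1 + eta then inverts 1 - theta. *)
have h : E k.+1 + (S + D k.+1) <= (1 + eta) * F.
  rewrite [leLHS](_ : _ = (1 + eta) * ((1 - theta) * (E k.+1 + (S + D k.+1)))).
    by rewrite ler_pM2l// /F; have := step k; have := mulr_ge0 t0 S0; nra.
  by rewrite mulrA et mul1r.
apply: (le_trans h).
have F_le : (1 + eta) * F <= (1 + eta) * (expR (k%:R * eta) * E 0%N).
  by rewrite ler_pM2l.
apply: (le_trans F_le).
rewrite mulrA ler_wpM2r// -natr1 [(_ + 1) * eta]mulrDl mul1r expRD mulrC.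
by rewrite ler_pM2l ?expR_gt0// expR_ge1Dx.
Qed.

(** * Energy balance of the scheme and its summation in time *)

Section Energy_estimate.
Variables (R : realType) (N k : nat) (Om : set 'rV[R]_N) (Sigma : set 'rV[R]_k).
Variable phi0 : 'rV[R]_k -> 'rV[R]_N.
Variable W : set ('rV[R]_k -> 'rV[R]_N).
Variable a_s : ('rV[R]_k -> 'rV[R]_N) -> ('rV[R]_k -> 'rV[R]_N) -> R.
Variables (Th : seq (simplex R N)) (Sh : seq (simplex R k)).
Variables (rhof rhos eps mu gamma tau alpha beta K : R) (r : nat).
Variables (u : nat -> 'rV[R]_N -> 'rV[R]_N) (p : nat -> 'rV[R]_N -> R).
Variables (ddot d lam : nat -> 'rV[R]_k -> 'rV[R]_N).
Hypotheses (mOm : measurable Om) (mSigma : measurable Sigma).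
Hypotheses (rhof0 : 0 < rhof) (rhos0 : 0 < rhos) (eps0 : 0 < eps)
  (mu0 : 0 < mu) (gamma0 : 0 < gamma) (tau0 : 0 < tau) (alpha0 : 0 < alpha)
  (beta0 : 0 < beta).
Hypotheses (hW : closed_H1_subspace Sigma W)
  (ha : elastic_form Sigma W a_s beta).
Hypothesis inverse_ineq : forall w, Wh Sigma W Sh w ->
  vnorm1 Sigma w <= K * vnorm0 Sigma w.
Hypothesis cfl : tau * beta * K ^+ 2 <= alpha.
Hypothesis r12 : r = 1%N \/ r = 2%N.
Hypothesis sol : scheme_solution Om Sigma phi0 W a_s Th Sh rhof rhos eps mu
  gamma tau r u p ddot d lam.

Local Notation E := (energy Om Sigma a_s rhof rhos eps u ddot d).

(** One step's dissipation with the weights produced by multiplying the tested scheme by 2 tau,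
    which makes the energy balance an identity. *)
Definition weighted_dissipation (n : nat) : R :=
  tau ^+ 2 * (rhof * vnorm0 Om (dtau tau u n) ^+ 2
              + rhos * eps * vnorm0 Sigma (dtau tau ddot n) ^+ 2)
  + 4 * mu * tau * strain_norm Om (u n) ^+ 2
  + 2 * tau * stab_norm Om Th gamma (p n) ^+ 2.

Local Notation dissip := weighted_dissipation.

Lemma weighted_dissipation_ge0 n : 0 <= dissip n.
Proof.
by apply: addr_ge0; first apply: addr_ge0;
  rewrite !(sqr_ge0, mulr_ge0, addr_ge0, ler0n) ?ltW.
Qed.

Lemma energy_ge0 n : 0 <= E n.
Proof. by rewrite /energy !(sqr_ge0, addr_ge0, mulr_ge0) ?ltW. Qed.

Lemma scheme_spaces n :
  [/\ Vh Om Th (u n), Wh Sigma W Sh (ddot n) & Wh Sigma W Sh (d n)].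
Proof.
case: n => [|n]; first by have [] := sol.
by have [_ _ _ _ /(_ n.+1 isT)[[]]] := sol.
Qed.

Let sqint_u n i : sqint Om (Defs.comp (u n) i).
Proof. by have [[/(_ i)[[]]]] := scheme_spaces n. Qed.

Let sqint_ddot n i : sqint Sigma (Defs.comp (ddot n) i).
Proof.
by have [_ [+ _] _] := scheme_spaces n => /(closed_H1_subspace_sqint hW).
Qed.

(** [K] stands for C_I / h_s: continuity and the inverse inequality give a(w,w) <= beta K^2 |w|_0^2,
    and one factor tau is spent on tau beta K^2 <= alpha. *)
Lemma elastic_form_le_L2 w : Wh Sigma W Sh w ->
  tau ^+ 2 * a_s w w <= tau * alpha * vip Sigma w w.
Proof.
move=> Ww; have [Wsw _] := Ww; rewrite -vnorm0_sqr.
have [_ _ _ /(_ _ _ Wsw Wsw)] := ha.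
have := inverse_ineq Ww; have := vnorm1_ge0 Sigma w.
have : 0 <= vnorm0 Sigma w by exact: sqrtr_ge0.
move: (vnorm1 Sigma w) (vnorm0 Sigma w) (a_s w w) => x y z y0 x0 xy zx.
have x2 : x ^+ 2 <= K ^+ 2 * y ^+ 2.
  by rewrite -exprMn ler_pXn2r// nnegrE//; exact: le_trans xy.
have zK : z <= beta * (K ^+ 2 * y ^+ 2).
  by apply: (le_trans zx); rewrite -mulrA -expr2 ler_pM2l.
apply: (@le_trans _ _ (tau ^+ 2 * (beta * (K ^+ 2 * y ^+ 2)))).
  by rewrite ler_pM2l// exprn_gt0.
rewrite (_ : tau ^+ 2 * _ = tau * ((tau * beta * K ^+ 2) * y ^+ 2)); last by ring.
by rewrite -[leRHS]mulrA ler_pM2l// ler_wpM2r// sqr_ge0.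
Qed.

(* Testing with [(u n, p n, ddot n, lam n)] cancels the coupling terms. *)
Lemma scheme_tested n :
  rhof * (tau^-1 * (vip Om (u n.+1) (u n.+1) - vip Om (u n) (u n.+1)))
  + 2 * mu * strain_ip Om (u n.+1) (u n.+1)
  + stab Om Th gamma (p n.+1) (p n.+1)
  + rhos * eps / tau *
    (vip Sigma (ddot n.+1) (ddot n.+1) - vip Sigma (ddot n) (ddot n.+1))
  = - a_s (extrapolation tau r ddot d n.+1) (ddot n.+1).
Proof.
have [_ _ _ _ /(_ n.+1 isT)[[Vu Qp Wdd Wd Ll] + _]] := sol.
move=> /(_ (u n.+1) (p n.+1) (ddot n.+1) (lam n.+1) Vu Qp Wdd Ll) <-.
rewrite (vip_scale_sub mOm tau^-1 (sqint_u n.+1) (sqint_u n) (sqint_u n.+1)).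
have -> : (fun x => ddot n.+1 x - ddot n x) =
    (fun x => 1 *: (ddot n.+1 x - ddot n x)).
  by apply/funext => x; rewrite scale1r.
rewrite (vip_scale_sub mSigma 1 (sqint_ddot n.+1) (sqint_ddot n)
  (sqint_ddot n.+1)) mul1r /fluid_form.
(* The pressure-divergence term [I] and the multiplier term [L] each occur twice, with opposite
   signs. *)
set I := ip _ _ _; set L := vip Sigma (lam _) _.
ring.
Qed.

Lemma energy_step n : E n.+1 + dissip n.+1 <=
  E n + tau * alpha / (rhos * eps) * (E n.+1 + dissip n.+1).
Proof.
have [Vu Wdd Wd] := scheme_spaces n.+1.
have [Vu' Wdd' Wd'] := scheme_spaces n.
have [Wsdd _] := Wdd; have [Wsd _] := Wd.
have [Wsdd' _] := Wdd'; have [Wsd' _] := Wd'.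
have dE : forall x, Sigma x -> d n.+1 x = d n x + tau *: ddot n.+1 x.
  by have [_ _ _ _ /(_ n.+1 isT)[_ _]] := sol.
have aE := elastic_form_expand mSigma hW ha Wsd Wsd' Wsdd dE.
have test := scheme_tested n.
have rs0 : 0 < rhos * eps by exact: mulr_gt0.
have ta0 : 0 < tau * alpha / (rhos * eps) by rewrite !(mulr_gt0, invr_gt0).
have uE := vnorm0_scale_sub mOm tau^-1 (sqint_u n.+1) (sqint_u n).
have ddE := vnorm0_scale_sub mSigma tau^-1 (sqint_ddot n.+1) (sqint_ddot n).
have dissE : dissip n.+1 =
    rhof * (vip Om (u n.+1) (u n.+1) - 2 * vip Om (u n) (u n.+1)
            + vip Om (u n) (u n))
    + rhos * eps * (vip Sigma (ddot n.+1) (ddot n.+1)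
        - 2 * vip Sigma (ddot n) (ddot n.+1) + vip Sigma (ddot n) (ddot n))
    + 4 * mu * tau * strain_ip Om (u n.+1) (u n.+1)
    + 2 * tau * stab Om Th gamma (p n.+1) (p n.+1).
  rewrite /dissip uE ddE !sqr_sqrtr ?strain_ip_ge0 ?stab_ge0 ?ltW//.
  by field; rewrite gt_eqF.
have ddB : vip Sigma (fun x => ddot n.+1 x - ddot n x)
      (fun x => ddot n.+1 x - ddot n x) =
    vip Sigma (ddot n.+1) (ddot n.+1) - 2 * vip Sigma (ddot n) (ddot n.+1)
    + vip Sigma (ddot n) (ddot n).
  have := vnorm0_scale_sub mSigma 1 (sqint_ddot n.+1) (sqint_ddot n).
  rewrite expr1n mul1r => <-; rewrite -vnorm0_sqr.
  by congr (vnorm0 _ _ ^+ 2); apply/funext => x; rewrite scale1r.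
have EE m : E m = rhof * vip Om (u m) (u m)
    + rhos * eps * vip Sigma (ddot m) (ddot m) + a_s (d m) (d m).
  have [_ _ [Wdm _]] := scheme_spaces m.
  by rewrite /energy !vnorm0_sqr (snorm_sqr ha).
(* The tested scheme times 2 tau, with 2 (x - y, x) = |x|^2 - |y|^2 + |x - y|^2 for both velocities;
   only elastic terms are left. *)
have balance : E n.+1 + dissip n.+1 - E n =
    2 * tau * a_s (d n) (ddot n.+1) + tau ^+ 2 * a_s (ddot n.+1) (ddot n.+1)
    - 2 * tau * a_s (extrapolation tau r ddot d n.+1) (ddot n.+1).
  rewrite -mulrN -test dissE !EE aE.
  by field; rewrite gt_eqF.
suff : E n.+1 + dissip n.+1 - E n <=
    tau * alpha / (rhos * eps) * (E n.+1 + dissip n.+1) by rewrite lerBlDl.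
(* It remains to find an L2 quantity x that controls the elastic terms and is itself contained in
   energy plus dissipation. *)
have bound x : rhos * eps * x <= E n.+1 + dissip n.+1 ->
    tau * alpha * x <= tau * alpha / (rhos * eps) * (E n.+1 + dissip n.+1).
  move=> h; rewrite -(ler_pM2l ta0) in h; apply: le_trans h.
  by rewrite mulrA divfK// gt_eqF.
have rsV m : 0 <= vip Om (u m) (u m) by exact: vip_ge0.
rewrite balance; case: r12 => ->; rewrite /extrapolation/=.
  (* For r = 1 the cross terms with [d n] cancel; x is the squared L2 norm of the new solid
     velocity, a part of the energy. *)
  rewrite [X in X <= _](_ : _ = tau ^+ 2 * a_s (ddot n.+1) (ddot n.+1));
    last by ring.
  apply: (le_trans (elastic_form_le_L2 Wdd)); apply: bound.
  rewrite -[leLHS]addr0; apply: lerD; last exact: weighted_dissipation_ge0.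
  rewrite EE; have := rsV n.+1; have := elastic_form_ge0 ha Wsd.
  have := rhof0; nra.
have -> : (fun x => d n x + tau *: ddot n x) = (fun x => tau *: ddot n x + d n x).
  by apply/funext => x; rewrite addrC.
rewrite (elastic_form_lincomb ha tau Wsdd' Wsd' Wsdd).
have Wb := WhB hW Wdd Wdd'.
have bE := elastic_form_sub hW ha Wsdd Wsdd'.
have a0 := elastic_form_ge0 ha Wsdd'.
(* For r = 2 what remains is tau^2 (|ddot (n+1) - ddot n|_s^2 - |ddot n|_s^2), and the negative
   square is dropped. *)
apply: (@le_trans _ _ (tau ^+ 2 * (a_s (fun x => ddot n.+1 x - ddot n x)
    (fun x => ddot n.+1 x - ddot n x)))).
  rewrite bE; have := mulr_ge0 (sqr_ge0 tau) a0; lra.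
apply: (le_trans (elastic_form_le_L2 Wb)); apply: bound.
(* Here x is the squared L2 norm of the solid velocity increment, a part of the dissipation; the
   remaining parts are nonnegative. *)
rewrite ddB.
have : 0 <= E n.+1 by exact: energy_ge0.
have : 0 <= vip Om (dtau tau u n.+1) (dtau tau u n.+1) by exact: vip_ge0.
rewrite -vnorm0_sqr uE pmulr_rge0 ?exprn_gt0 ?invr_gt0// => h1 h2.
have h3 := mulr_ge0 (ltW rhof0) h1.
have h4 : 0 <= 4 * mu * tau * strain_ip Om (u n.+1) (u n.+1).
  by rewrite !mulr_ge0 ?strain_ip_ge0 ?ltW.
have h5 : 0 <= 2 * tau * stab Om Th gamma (p n.+1) (p n.+1).
  by rewrite mulr_ge0 ?stab_ge0 ?mulr_ge0 ?ltW.
rewrite dissE; lra.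
Qed.

(** The strain weight tau needs the factor 1/(4 mu) against 4 mu tau, the other weights need only
    the factor 1; the sum of both factors covers every term. *)
Lemma dissipation_le n :
  dissipation Om Sigma Th rhof rhos eps gamma tau u p ddot n <=
  (1 + (4 * mu)^-1) * \sum_(1 <= m < n.+1) dissip m.
Proof.
rewrite /dissipation !mulr_sumr -big_split/=; apply: ler_sum => m _.
rewrite /dissip.
have s_ge0 := sqr_ge0 (strain_norm Om (u m)).
have q_ge0 := sqr_ge0 (stab_norm Om Th gamma (p m)).
have x_ge0 := mulr_ge0 (ltW rhof0) (sqr_ge0 (vnorm0 Om (dtau tau u m))).
have y_ge0 := mulr_ge0 (ltW (mulr_gt0 rhos0 eps0))
  (sqr_ge0 (vnorm0 Sigma (dtau tau ddot m))).
move: s_ge0 q_ge0 x_ge0 y_ge0.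
move: (strain_norm _ _ ^+ 2) (stab_norm _ _ _ _ ^+ 2) (rhof * _)
  (rhos * eps * _) => s q x y s_ge0 q_ge0 x_ge0 y_ge0.
have i0 : 0 < (4 * mu)^-1 by rewrite invr_gt0 mulr_gt0.
rewrite (_ : (1 + _) * _ = (1 + (4 * mu)^-1) * (tau ^+ 2 * (x + y))
   + (4 * mu * tau * s + tau * s) + (1 + (4 * mu)^-1) * (2 * tau * q)); last first.
  by field; rewrite gt_eqF.
have t2 : 0 <= tau ^+ 2 * (x + y) by rewrite mulr_ge0 ?sqr_ge0 ?addr_ge0.
have tq := mulr_ge0 (ltW tau0) q_ge0.
have ts := mulr_ge0 (mulr_ge0 (ltW mu0) (ltW tau0)) s_ge0.
have h1 := mulr_ge0 (ltW i0) t2.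
have h2 := mulr_ge0 (ltW i0) tq.
lra.
Qed.

Hypothesis theta_lt1 : tau * alpha < rhos * eps.

Lemma energy_estimate n :
  E n + dissipation Om Sigma Th rhof rhos eps gamma tau u p ddot n <=
  (1 + (4 * mu)^-1) *
  expR (tau * \sum_(1 <= m < n.+1) (alpha / (rhos * eps - tau * alpha))) * E 0%N.
Proof.
have rs0 : 0 < rhos * eps by exact: mulr_gt0.
have i0 : 0 < (4 * mu)^-1 by rewrite invr_gt0 mulr_gt0.
have C0 : 0 < 1 + (4 * mu)^-1 by exact: addr_gt0.
have := dissipation_le n.
have := @discrete_gronwall R E dissip (tau * alpha / (rhos * eps))
  (tau * (alpha / (rhos * eps - tau * alpha))) (energy_ge0 0).
move=> /(_ _ _ _ weighted_dissipation_ge0 energy_step n) gron dle.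
have -> : tau * \sum_(1 <= m < n.+1) (alpha / (rhos * eps - tau * alpha)) =
    n%:R * (tau * (alpha / (rhos * eps - tau * alpha))).
  by rewrite sumr_const_nat subSS subn0 -[_ *+ n]mulr_natl mulrCA.
rewrite -mulrA; apply: le_trans (ler_wpM2l (ltW C0) (gron _ _ _)).
(* The energy is absorbed because the constant is at least 1, the dissipation by
   [dissipation_le]. *)
- rewrite mulrDr lerD//.
  by rewrite mulrDl mul1r lerDl mulr_ge0 ?energy_ge0// ltW.
- by rewrite ltW// !(mulr_gt0, invr_gt0).
- by rewrite ltr_pdivrMr// mul1r.
- by field; rewrite subr_eq0 !gt_eqF.
Qed.

End Energy_estimate.

(** * Stability with a constant uniform over the mesh families *)

Theorem theorem4p3p1 (R : realType) (N : nat) (hN : N = 2%N \/ N = 3%N)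
  (Om : set 'rV[R]_N) (hOm : polyhedral Om) (hOmc : connected Om)
  (Sigma : set 'rV[R]_N.-1) (hSigma : polyhedral Sigma)
  (phi0 : 'rV[R]_N.-1 -> 'rV[R]_N)
  (hphi0 : forall x, Sigma x -> Om (phi0 x))
  (rhof rhos eps mu gamma : R)
  (hrhof : 0 < rhof) (hrhos : 0 < rhos) (heps : 0 < eps) (hmu : 0 < mu)
  (hgamma : 0 < gamma)
  (W : set ('rV[R]_N.-1 -> 'rV[R]_N)) (hW : closed_H1_subspace Sigma W)
  (a_s : ('rV[R]_N.-1 -> 'rV[R]_N) -> ('rV[R]_N.-1 -> 'rV[R]_N) -> R)
  (beta_s : R) (hbeta : 0 < beta_s) (ha : elastic_form Sigma W a_s beta_s)
  (J : Type) (T : J -> seq (simplex R N)) (S : J -> seq (simplex R N.-1))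
  (hT : regular_family Om T) (hS : quasi_uniform_family Sigma S)
  (C_I : R) (hCI : 0 < C_I)
  (hinv : forall (j : J) (w : 'rV[R]_N.-1 -> 'rV[R]_N), Wh Sigma W (S j) w ->
    vnorm1 Sigma w <= C_I * (mesh_size (S j))^-1 * vnorm0 Sigma w) :
  exists2 C : R, 0 < C &
  forall (j : J) (tau alpha : R) (r : nat)
    (u : nat -> 'rV[R]_N -> 'rV[R]_N) (p : nat -> 'rV[R]_N -> R)
    (ddot d lam : nat -> 'rV[R]_N.-1 -> 'rV[R]_N),
  0 < tau -> r = 1%N \/ r = 2%N ->
  scheme_solution Om Sigma phi0 W a_s (T j) (S j) rhof rhos eps mu gamma tau
    r u p ddot d lam ->
  0 < alpha ->
  tau * beta_s * C_I ^+ 2 / mesh_size (S j) ^+ 2 <= alpha ->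
  tau * alpha < rhos * eps ->
  forall n : nat, (1 <= n)%N ->
  energy Om Sigma a_s rhof rhos eps u ddot d n
  + dissipation Om Sigma (T j) rhof rhos eps gamma tau u p ddot n
  <= C * expR (tau * \sum_(1 <= m < n.+1) (alpha / (rhos * eps - tau * alpha)))
     * energy Om Sigma a_s rhof rhos eps u ddot d 0.
Proof.
(* The constant depends on mu alone, hence not on the mesh, tau, alpha, r or n. *)
exists (1 + (4 * mu)^-1); first by rewrite addr_gt0// invr_gt0 mulr_gt0.
move=> j tau alpha r u p ddot d lam tau0 r12 sol alpha0 cfl tau_alpha n _.
apply: (energy_estimate (W := W) (Sh := S j) (phi0 := phi0) (lam := lam)
  (beta := beta_s) (K := C_I * (mesh_size (S j))^-1) (r := r)) => //.
- exact: polyhedral_measurable.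
- exact: polyhedral_measurable.
- exact: hinv.
- by rewrite exprMn exprVn mulrA.
Qed.
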